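(* Let $H_m=H_{(m)}$ for $m\ge1$ and $\tilde H_n=H_{(\dot n)}$ for $n\ge0$. Then $${\rm sNSym}\cong\mathbb Q\langle H_1,H_2,\dots;\tilde H_0,\tilde H_1,\dots\rangle,$$ the free associative algebra with noncommuting generators $\{H_1,H_2,\dots;\tilde H_0,\tilde H_1,\dots\}$, with coproduct defined by $$\Delta H_n=\sum_{i+j=n}H_i\otimes H_j\qquad\text{and}\qquad\Delta\tilde H_i=\sum_{k+\ell=i}\left(\tilde H_k\otimes H_\ell+H_\ell\otimes\tilde H_k\right),$$ where the sums are over pairs of non-negative integers and $H_0=1$.
   Context: Variables $x_1,x_2,\dots$ commute; $\theta_1,\theta_2,\dots$ anticommute ($\theta_i\theta_j=-\theta_j\theta_i$, $\theta_i^2=0$). A dotted composition $\alpha=(\alpha_1,\dots,\alpha_l)$ is a finite (possibly empty) sequence whose entries belong to $\{1,2,3,\dots\}$ (non-dotted) or $\{\dot0,\dot1,\dot2,\dots\}$ (dotted); its fermionic degree is its number of dotted parts. Put $\eta_i=1$ if $\alpha_i$ is dotted and $\eta_i=0$ otherwise. ${\rm sQSym}$ is the $\mathbb Q$-algebra of quasisymmetric functions in superspace, with basis $M_\alpha=\sum_{i_1<\cdots<i_l}\theta_{i_1}^{\eta_1}\cdots\theta_{i_l}^{\eta_l}x_{i_1}^{\alpha_1}\cdots x_{i_l}^{\alpha_l}$ over all dotted compositions $\alpha$ (dots ignored in exponents of $x$; $M_\emptyset=1$), multiplied as power series of bounded degree. It is a graded connected Hopf algebra (graded by the sum of the degrees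 in $x$ and in $\theta$, with finite-dimensional homogeneous components), with coproduct $\Delta(M_\alpha)=\sum_{k=0}^lM_{(\alpha_1,\dots,\alpha_k)}\otimes M_{(\alpha_{k+1},\dots,\alpha_l)}$, the tensor square carrying the product $(f_1\otimes g_1)(f_2\otimes g_2)=(-1)^{ab}f_1f_2\otimes g_1g_2$ for $g_1,f_2$ of fermionic degrees $a,b$. The ring ${\rm sNSym}$ of noncommutative symmetric functions in superspace is the (graded) Hopf dual of ${\rm sQSym}$, with dual pairing $\langle\cdot,\cdot\rangle:{\rm sNSym}\otimes{\rm sQSym}\to\mathbb Q$ and $\mathbb Q$-basis $\{H_\alpha\}$, indexed by dotted compositions, dual to the monomials: $\langle H_\alpha,M_\beta\rangle=\delta_{\alpha\beta}$. $H_\alpha$ has the fermionic degree of $\alpha$. Being dually paired means that, for all $F,G\in{\rm sNSym}$ and $a,b\in{\rm sQSym}$, $\langle FG,a\rangle=\langle F\otimes G,\Delta(a)\rangle$, $\langle F,ab\rangle=\langle\Delta(F),a\otimes b\rangle$, $\langle1,a\rangle=\epsilon(a)$, $\langle F,1\rangle=\epsilon(F)$ and $\langle S(F),a\rangle=\langle F,S(a)\rangle$ ($\epsilon$ the counits, $S$ the antipodes). Here the pairing of tensors is $\langle\cdot,\cdot\rangle\otimes\langle\cdot,\cdot\rangle$ preceded by the signed twist $G\otimes a\mapsto(-1)^{\deg(G)\deg(a)}a\otimes G$ of the two middle factors, that is, $\langle F\otimes G,a\otimes b\rangle=(-1)^{\deg(G)\deg(a)}\langle F,a\rangle\langle G,b\rangle$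 for homogeneous elements, where $\deg$ is the fermionic degree. The tensor square of ${\rm sNSym}$ carries the same signed product as that of ${\rm sQSym}$; the coproduct of ${\rm sNSym}$ is an algebra morphism for it, so it is determined by its values on generators. *)

(* Defs.v *)
From HB Require Import structures.
From mathcomp Require Import all_boot all_order all_algebra.
From mathcomp Require Import finmap.
From mathcomp.multinomials Require Import monalg.

Set Implicit Arguments.
Unset Strict Implicit.
Unset Printing Implicit Defensive.

Import GRing.Theory.
Local Open Scope ring_scope.

Section LinearExtension.
Variables (K : choiceType) (V : lmodType rat).

Definition lext (f : K -> V) (a : {malg rat[K]}) : V :=
  \sum_(k <- msupp a) a@_k *: f k.

Lemma unlock_lext f a : lext f a = \sum_(k <- msupp a) a@_k *: f k.
Proof. by []. Qed.

Lemma lextEw (f : K -> V) (d : {fset K}) a :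
  (msupp a `<=` d)%fset -> lext f a = \sum_(k <- d) a@_k *: f k.
Proof.
move=> le_ad; rewrite /lext (big_fset_incl _ le_ad) //.
by move=> k _ /mcoeff_outdom ->; rewrite scale0r.
Qed.

Lemma lext_is_linear f : linear (lext f).
Proof.
move=> c a b; pose d := (msupp a `|` msupp b `|` msupp (c *: a + b))%fset.
rewrite !(@lextEw f d) ?fsubsetUr //; last first.
- by rewrite /d -fsetUA fsubsetUl.
- by rewrite /d -fsetUA fsetUCA fsubsetUl.
rewrite scaler_sumr -big_split /=; apply: eq_bigr => k _.
by rewrite mcoeffD mcoeffZ scalerDl scalerA.
Qed.

HB.instance Definition _ f :=
  GRing.isLinear.Build rat {malg rat[K]} V _ (lext f) (lext_is_linear f).

Lemma lextU f k : lext f << k >> = f k.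
Proof. by rewrite /lext msuppU oner_eq0 big_seq_fset1 mcoeffUU scale1r. Qed.

Lemma malgE_lin (a : {malg rat[K]}) :
  a = \sum_(k <- msupp a) a@_k *: << k >>.
Proof.
rewrite [LHS]monalgE; apply: eq_bigr => k _.
by apply/malgP => l; rewrite mcoeffZ !mcoeffU mulrnAr mulr1.
Qed.

Lemma lext_unique (f : {linear {malg rat[K]} -> V}) a :
  f a = lext (fun k => f << k >>) a.
Proof.
rewrite {1}[a]malgE_lin linear_sum; apply: eq_bigr => k _.
by rewrite linearZ.
Qed.

Lemma eq_lext (f g : K -> V) : f =1 g -> lext f =1 lext g.
Proof. by move=> fg a; apply: eq_bigr => k _; rewrite fg. Qed.

End LinearExtension.

Lemma linear_basis_eq (K : choiceType) (V : lmodType rat)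
    (f g : {linear {malg rat[K]} -> V}) :
  (forall k, f << k >> = g << k >>) -> f =1 g.
Proof. by move=> fg a; rewrite (lext_unique f) (lext_unique g); apply: eq_lext. Qed.

Section BilinearExtension.
Variables (K L : choiceType) (V : lmodType rat) (f : K -> L -> V).

Definition blext (a : {malg rat[K]}) (b : {malg rat[L]}) : V :=
  lext (fun k => lext (f k) b) a.

Lemma blext_linear_l b : linear (fun a => blext a b).
Proof. by move=> c x y; rewrite /blext linearP. Qed.

Lemma blext_linear_r a : linear (blext a).
Proof.
move=> c x y; rewrite /blext ![lext (fun k => _) a]unlock_lext.
rewrite scaler_sumr -big_split /=; apply: eq_bigr => k _.
by rewrite linearP scalerDr !scalerA (mulrC c).
Qed.

HB.instance Definition _ a :=
  GRing.isLinear.Build rat {malg rat[L]} V _ (blext a) (blext_linear_r a).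

Lemma blextU k l : blext << k >> << l >> = f k l.
Proof. by rewrite /blext !lextU. Qed.

End BilinearExtension.

(* [(true, n)] is the dotted part n, [(false, n)] the non-dotted part n >= 1 *)
Definition part := {p : bool * nat | p.1 || (0 < p.2)%N}.
Definition dcomp := seq part.

Definition dotted (p : part) : bool := (val p).1.

Definition dot (n : nat) : part := exist _ (true, n) isT.
(* the non-dotted part [m.+1] *)
Definition nondotS (m : nat) : part := exist _ (false, m.+1) isT.

Definition ferm (alpha : dcomp) : nat := count dotted alpha.

Definition wt (c : bool * nat) : nat := c.2 + c.1.
Definition deg (alpha : dcomp) : nat := \sum_(p <- alpha) wt (val p).

(* the dotted compositions of degree d; n bounds the number of parts *)
Fixpoint dcomps_rec (n d : nat) : seq dcomp :=
  if d == 0%N then [:: [::]] else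
  if n is n'.+1 then
    flatten [seq [seq p :: alpha | p <- [:: nondotS k; dot k],
                                   alpha <- dcomps_rec n' (d - k.+1)]
            | k <- iota 0 d]
  else [::].
Definition dcomps (d : nat) : seq dcomp := dcomps_rec d d.

Lemma val_nz (p : part) : val p != (false, 0%N).
Proof. by case: p => [[[] n] //= h]; rewrite xpair_eqE; case: n h. Qed.

Lemma wt_nondotS k : wt (val (nondotS k)) = k.+1.
Proof. by rewrite /wt /= addn0. Qed.

Lemma wt_dot k : wt (val (dot k)) = k.+1.
Proof. by rewrite /wt /= addn1. Qed.

Lemma wt_gt0 (p : part) : (0 < wt (val p))%N.
Proof. by case: p => [[[] []] h]. Qed.

Lemma part_wt (p : part) : p \in [:: nondotS (wt (val p)).-1; dot (wt (val p)).-1].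
Proof.
suff: p = nondotS (wt (val p)).-1 \/ p = dot (wt (val p)).-1.
  by rewrite !inE => -[] <-; rewrite eqxx ?orbT.
case: p => [[[] n] h]; [right | left]; apply/val_inj; rewrite /= /wt /=.
  by rewrite addn1.
by rewrite addn0 prednK.
Qed.

Lemma deg_cons p alpha : deg (p :: alpha) = (wt (val p) + deg alpha)%N.
Proof. exact: big_cons. Qed.

Lemma deg_cat alpha beta : deg (alpha ++ beta) = (deg alpha + deg beta)%N.
Proof. exact: big_cat. Qed.

Lemma ferm_cat alpha beta : ferm (alpha ++ beta) = (ferm alpha + ferm beta)%N.
Proof. exact: count_cat. Qed.

Lemma deg_eq0 alpha : (deg alpha == 0%N) = (alpha == [::]).
Proof.
case: alpha => [|p alpha]; first by rewrite /deg big_nil.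
by rewrite deg_cons addn_eq0 -leqn0 leqNgt wt_gt0.
Qed.

Definition dcomps_step n d k : seq dcomp :=
  [seq p :: alpha | p <- [:: nondotS k; dot k], alpha <- dcomps_rec n (d - k.+1)].

Lemma dcomps_recS n d : d != 0%N ->
  dcomps_rec n.+1 d = flatten [seq dcomps_step n d k | k <- iota 0 d].
Proof. by rewrite {1}/dcomps_rec -/dcomps_rec; case: eqP. Qed.

Lemma mem_dcomps_step n d k alpha :
  reflect (exists p beta, [/\ alpha = p :: beta, wt (val p) = k.+1
                            & beta \in dcomps_rec n (d - k.+1)])
          (alpha \in dcomps_step n d k).
Proof.
apply: (iffP idP) => [|[p [beta [-> p_k in_beta]]]].
  case/allpairsPdep => [p [beta [p_k in_beta ->]]]; exists p, beta; split=> //.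
  by move: p_k; rewrite !inE => /orP [] /eqP ->; rewrite ?wt_nondotS ?wt_dot.
by apply/allpairsPdep; exists p, beta; split; rewrite // -[k]/k.+1.-1 -p_k part_wt.
Qed.

Lemma mem_dcomps_rec n d alpha :
  (d <= n)%N -> (alpha \in dcomps_rec n d) = (deg alpha == d).
Proof.
elim: n d alpha => [|n IHn] d alpha.
  by rewrite leqn0 => /eqP ->; rewrite /= inE deg_eq0.
have [->|d_neq0 le_dn] := eqVneq d 0%N; first by rewrite /= inE deg_eq0.
rewrite dcomps_recS //.
apply/flatten_mapP/eqP => [[k]|].
  rewrite mem_iota /= add0n => lt_kd /mem_dcomps_step [p [beta [-> p_k]]].
  rewrite IHn; first by move=> /eqP deg_beta; rewrite deg_cons deg_beta p_k subnKC.
  by rewrite leq_subLR (leq_trans le_dn) // addSn ltnS leq_addl.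
case: alpha => [|p alpha] deg_d; first by rewrite -deg_d /deg big_nil in d_neq0.
exists (wt (val p)).-1.
  by rewrite mem_iota /= add0n prednK ?wt_gt0 // -deg_d deg_cons leq_addr.
apply/mem_dcomps_step; exists p, alpha; rewrite prednK ?wt_gt0 //; split=> //.
rewrite -deg_d deg_cons addKn IHn //.
rewrite -ltnS (leq_trans _ le_dn) // -deg_d deg_cons -addn1 addnC leq_add2r.
exact: wt_gt0.
Qed.

Lemma dcomps_rec_uniq n d : uniq (dcomps_rec n d).
Proof.
elim: n d => [|n IHn] d; first by rewrite /=; case: eqP.
have [->|d_neq0] := eqVneq d 0%N; first by [].
rewrite dcomps_recS //; have := @iota_uniq 0 d.
elim: (iota 0 d) => // k s IHs /andP[k_s s_uniq].
rewrite [flatten _]/= cat_uniq IHs // andbT; apply/andP; split.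
  by apply: allpairs_uniq_dep => // [[p a] [q b]] _ _ /= [-> ->].
apply/hasPn => alpha /flatten_mapP [j j_s /mem_dcomps_step [p [beta [def_a wt_p _]]]].
apply/negP => /mem_dcomps_step [q [b [def_a' wt_q _]]].
move: def_a'; rewrite def_a => -[pq _]; move: wt_q; rewrite -pq wt_p => -[jk].
by rewrite -jk j_s in k_s.
Qed.

Lemma mem_dcomps d alpha : (alpha \in dcomps d) = (deg alpha == d).
Proof. exact: mem_dcomps_rec. Qed.

Lemma dcomps_uniq d : uniq (dcomps d).
Proof. exact: dcomps_rec_uniq. Qed.

(* The list w stands for the monomial
   theta_1^(w_1).1 ... theta_n^(w_n).1 x_1^(w_1).2 ... x_n^(w_n).2, n = size w
   so w and [rcons w (false, 0)] stand for the same monomial. *)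
Definition smon := seq (bool * nat).

Definition nz (c : bool * nat) : bool := c != (false, 0%N).

(* A formal power series in the x_i and theta_i is the family of its
   coefficients, of which those of w and [rcons w (false, 0)] agree. *)
Record sseries := SSeries {
  coef :> smon -> rat;
  coef_pad : forall w, coef (rcons w (false, 0%N)) = coef w
}.

(* theta_{i_1}^{eta_1} ... theta_{i_l}^{eta_l} x_{i_1}^{alpha_1} ... x_{i_l}^{alpha_l}
   as a monomial in the first n variables (numbered from 0), where
   i_1 < ... < i_l < n *)
Definition Mterm (i : seq nat) (alpha : dcomp) (n : nat) : smon :=
  mkseq (fun j => nth (false, 0%N) (map val alpha) (index j i)) n.

(* the terms of M_alpha with an i_l >= size w cannot equal w *)
Definition Mcoef (alpha : dcomp) (w : smon) : rat :=
  \sum_(i : (size alpha).-tuple 'I_(size w) | sorted ltn (map val i))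
     (w == Mterm (map val i) alpha (size w))%:R.

Definition lead (alpha : dcomp) : smon := map val alpha.

Lemma lead_inj : injective lead.
Proof. exact/inj_map/val_inj. Qed.

Lemma filter_lead alpha : filter nz (lead alpha) = lead alpha.
Proof. by apply/all_filterP/allP => _ /mapP[p _ ->]; exact: val_nz. Qed.

Definition supp (w : smon) : seq nat :=
  [seq j <- iota 0 (size w) | nz (nth (false, 0%N) w j)].

Lemma mem_supp w j : (j \in supp w) = nz (nth (false, 0%N) w j).
Proof.
rewrite mem_filter mem_iota /= add0n.
by case: ltnP => [|le_wj]; rewrite ?andbT // nth_default.
Qed.

Lemma supp_sorted w : sorted ltn (supp w).
Proof. by apply: sorted_filter; [exact: ltn_trans | exact: iota_ltn_sorted]. Qed.

Lemma supp_nth w : map (nth (false, 0%N) w) (supp w) = filter nz w.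
Proof. by rewrite /supp -filter_map -/(mkseq _ _) mkseq_nth. Qed.

Lemma Mterm_supp w alpha (i : seq nat) :
  sorted ltn i -> size i = size alpha -> all (fun j => j < size w)%N i ->
  w = Mterm i alpha (size w) <-> filter nz w = lead alpha /\ i = supp w.
Proof.
move=> i_sorted sz_i i_lt; have i_uniq := sorted_uniq ltn_trans ltnn i_sorted.
split=> [def_w | [fw def_i]].
  have nth_w j : nth (false, 0%N) w j = nth (false, 0%N) (lead alpha) (index j i).
    have [lt_j|le_j] := ltnP j (size w); first by rewrite {1}def_w nth_mkseq.
    rewrite !nth_default // size_map -sz_i leqNgt index_mem.
    by apply/negP => /(allP i_lt); rewrite ltnNge le_j.
  have def_i : i = supp w.
    apply: (irr_sorted_eq ltn_trans ltnn) => // [|j]; first exact: supp_sorted.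
    rewrite mem_supp nth_w; case: (boolP (j \in i)) => j_i; last first.
      by rewrite nth_default // size_map -sz_i leqNgt index_mem.
    have lt_ji : (index j i < size (lead alpha))%N by rewrite size_map -sz_i index_mem.
    by have /mapP[p _ ->] := mem_nth (false, 0%N) lt_ji; rewrite /nz val_nz.
  split=> //; rewrite -supp_nth -def_i; apply: (@eq_from_nth _ (false, 0%N)).
    by rewrite !size_map.
  move=> k; rewrite size_map => lt_k; rewrite (nth_map 0%N) // nth_w.
  by rewrite index_uniq.
apply: (@eq_from_nth _ (false, 0%N)); first by rewrite size_mkseq.
move=> j lt_j; rewrite nth_mkseq // -/(lead alpha) -fw -supp_nth -def_i.
case: (boolP (j \in i)) => j_i; last first.
  rewrite [RHS]nth_default; last by rewrite size_map leqNgt index_mem.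
  by move: j_i; rewrite def_i mem_supp negbK => /eqP.
by rewrite (nth_map 0%N) ?index_mem // nth_index.
Qed.

Lemma McoefE alpha w : Mcoef alpha w = (filter nz w == lead alpha)%:R.
Proof.
rewrite /Mcoef; pose P (i : (size alpha).-tuple 'I_(size w)) := sorted ltn (map val i).
have termE (i : (size alpha).-tuple 'I_(size w)) : P i ->
    (w == Mterm (map val i) alpha (size w)) =
    (filter nz w == lead alpha) && (map val i == supp w).
  move=> Pi; apply/eqP/andP.
    case/Mterm_supp=> // [||-> ->] //; first by rewrite size_map size_tuple.
    by apply/allP => _ /mapP[j _ ->] /=.
  case=> /eqP fw /eqP def_i; apply/Mterm_supp => //.
    by rewrite size_map size_tuple.
  by apply/allP => _ /mapP[j _ ->] /=.
under eq_bigr => i Pi do rewrite termE //.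
case: eqP => [fw|_] /=; last by rewrite big1.
have sz_s : size (supp w) = size alpha.
  by rewrite -(size_map (nth (false, 0%N) w)) supp_nth fw size_map.
have lt_s : all (fun j => j < size w)%N (supp w).
  by apply/allP => j; rewrite mem_filter mem_iota => /andP[].
have [s val_s] : exists s : seq 'I_(size w), map val s = supp w.
  elim: (supp w) lt_s => [|j s IHs] /=; first by exists [::].
  by case/andP=> lt_j /IHs[t <-]; exists (Ordinal lt_j :: t).
have sz : size s == size alpha by rewrite -(size_map val) val_s sz_s.
rewrite (bigD1 (Tuple sz)) /=; last by rewrite val_s supp_sorted.
rewrite val_s eqxx big1 ?addr0 // => i /andP[_ ne_i].
case: eqP => // def_i; case/eqP: ne_i; apply: val_inj => /=.
by apply: (inj_map val_inj); rewrite def_i.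
Qed.

Lemma Mcoef_pad alpha w : Mcoef alpha (rcons w (false, 0%N)) = Mcoef alpha w.
Proof. by rewrite !McoefE filter_rcons. Qed.

Definition M (alpha : dcomp) : sseries := SSeries (Mcoef_pad alpha).

(* the ways to write (theta^e x^a) as +-(theta^e1 x^a1)(theta^e2 x^a2) *)
Definition splits1 (c : bool * nat) : seq ((bool * nat) * (bool * nat)) :=
  [seq ((e, a), (c.1 (+) e, (c.2 - a)%N)) |
     e <- if c.1 then [:: true; false] else [:: false], a <- iota 0 c.2.+1].

(* the pairs (u, v) of monomials with uv = +- w, see mem_splits *)
Fixpoint splits (w : smon) : seq (smon * smon) :=
  if w is c :: w' then
    [seq (s.1 :: p.1, s.2 :: p.2) | s <- splits1 c, p <- splits w']
  else [:: ([::], [::])].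

(* the number of transpositions needed to sort the product of the thetas of u
   with the thetas of v *)
Definition inv (u v : smon) : nat :=
  \sum_(i < size u) \sum_(j < size v)
     [&& (j < i)%N, (nth (false, 0%N) u i).1 & (nth (false, 0%N) v j).1].

Definition scoefM (f g : smon -> rat) (w : smon) : rat :=
  \sum_(p <- splits w) (-1) ^+ inv p.1 p.2 * (f p.1 * g p.2).

Lemma mem_splits1 c a b : ((a, b) \in splits1 c) =
  [&& ~~ (a.1 && b.1), c.1 == a.1 || b.1 & c.2 == (a.2 + b.2)%N].
Proof.
apply/idP/idP.
  case/allpairsPdep => e [k [e_c]]; rewrite mem_iota /= add0n ltnS => le_k [-> ->] /=.
  rewrite subnKC // eqxx andbT; case: c e_c {le_k} => [[] n] /=; rewrite !inE.
    by case/orP => /eqP ->.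
  by move/eqP ->.
case: a b c => [e k] [e' k'] [d n] /= /and3P [ee' /eqP -> /eqP ->].
apply/allpairsPdep; exists e, k; split.
- by case: e e' ee' => [] [].
- by rewrite mem_iota /= add0n ltnS leq_addr.
by rewrite /= addKn; case: e e' ee' => [] [].
Qed.

Lemma splits1_uniq c : uniq (splits1 c).
Proof.
apply: allpairs_uniq_dep; first by case: c => [[] n].
  by move=> e _; exact: iota_uniq.
by move=> [e k] [e' k'] _ _ /= [-> -> _ _].
Qed.

Lemma mem_splits w u v : reflect
  [/\ size u = size w, size v = size w &
      forall i, let a := nth (false, 0%N) u i in let b := nth (false, 0%N) v i in
      ~~ (a.1 && b.1) /\ nth (false, 0%N) w i = (a.1 || b.1, (a.2 + b.2)%N)]
  ((u, v) \in splits w).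
Proof.
elim: w u v => [|c w IHw] u v /=.
  rewrite inE; apply: (iffP eqP) => [[-> ->]|]; first by split=> // i; rewrite nth_nil.
  by case: u v => [|? ?] [|? ?] [].
apply: (iffP idP).
  case/allpairsPdep => [[a b] [[u' v'] [/= ]]]; rewrite mem_splits1.
  case/and3P => ab1 /eqP c1 /eqP c2 /IHw [sz_u sz_v uv] [-> ->] /=.
  rewrite sz_u sz_v; split=> // [[|i]] /=; last exact: uv.
  by rewrite -c1 -c2; case: (c).
case: u v => [|a u] [|b v] [] //= [sz_u] [sz_v] uv.
apply/allpairsPdep; exists (a, b), (u, v); split=> //.
  by rewrite mem_splits1; have [/= -> ->] := uv 0%N; rewrite /= !eqxx.
by apply/IHw; split=> // i; apply: (uv i.+1).
Qed.

Lemma splits_uniq w : uniq (splits w).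
Proof.
elim: w => //= c w IHw; apply: allpairs_uniq_dep; first exact: splits1_uniq.
  by move=> *; exact: IHw.
by move=> [[a b] [u v]] [[a' b'] [u' v']] _ _ /= [-> -> -> ->].
Qed.

Definition thdeg (u : smon) : nat := count (fun c => c.1) u.

Lemma inv_cons a b u v : inv (a :: u) (b :: v) = (inv u v + b.1 * thdeg u)%N.
Proof.
rewrite /inv /= big_ord_recl /= big1 ?add0n //.
under eq_bigr => i _ do rewrite big_ord_recl.
rewrite big_split /= addnC; congr addn; rewrite /thdeg -sum1_count.
rewrite (big_nth (false, 0%N)) big_mkord big_distrr [RHS]big_mkcond /=.
apply: eq_bigr => i _; rewrite add0n muln1.
by case: (nth _ _ _).1.
Qed.

Lemma scoefM_nil f g : scoefM f g [::] = f [::] * g [::].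
Proof. by rewrite /scoefM big_seq1 /= /inv big_ord0 mul1r. Qed.

Lemma scoefM_cons f g c w :
  scoefM f g (c :: w) =
  \sum_(s <- splits1 c)
     scoefM (fun u => (-1) ^+ (s.2.1 * thdeg u) * f (s.1 :: u))
            (fun v => g (s.2 :: v)) w.
Proof.
rewrite /scoefM /= big_allpairs_dep; apply: eq_bigr => s _.
by apply: eq_bigr => p _; rewrite inv_cons exprD !mulrA.
Qed.

Lemma eq_scoefM f f' g g' w :
  f =1 f' -> g =1 g' -> scoefM f g w = scoefM f' g' w.
Proof. by move=> ff gg; apply: eq_bigr => p _; rewrite ff gg. Qed.

Lemma splits1_0 : splits1 (false, 0%N) = [:: ((false, 0%N), (false, 0%N))].
Proof. by []. Qed.

Lemma scoefM_pad (f g : smon -> rat) w :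
  (forall u, f (rcons u (false, 0%N)) = f u) ->
  (forall u, g (rcons u (false, 0%N)) = g u) ->
  scoefM f g (rcons w (false, 0%N)) = scoefM f g w.
Proof.
elim: w f g => [|c w IHw] f g fP gP.
  rewrite /= scoefM_cons splits1_0 big_seq1 !scoefM_nil /= mul1r.
  by rewrite (fP [::]) (gP [::]).
rewrite rcons_cons !scoefM_cons; apply: eq_bigr => s _.
apply: IHw => u; last by rewrite -rcons_cons gP.
by rewrite -rcons_cons fP /thdeg -cats1 count_cat addn0.
Qed.

Definition smul (f g : sseries) : sseries :=
  SSeries (fun w => scoefM_pad w (coef_pad f) (coef_pad g)).

Lemma scoefM_quasi (f g : smon -> rat) w :
  (forall u, f u = f (filter nz u)) -> (forall u, g u = g (filter nz u)) ->
  scoefM f g w = scoefM f g (filter nz w).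
Proof.
have thF u : thdeg (filter nz u) = thdeg u.
  rewrite /thdeg count_filter; apply: eq_count => -[[] n] //=.
elim: w f g => [//|c w IHw] f g fP gP.
have fP' a u : f (a :: u) = f (a :: filter nz u).
  rewrite fP [RHS]fP /=; case: ifP => _; rewrite filter_id //.
have gP' a u : g (a :: u) = g (a :: filter nz u).
  rewrite gP [RHS]gP /=; case: ifP => _; rewrite filter_id //.
rewrite /= {1}/nz; case: eqP => [->|_] /=.
  rewrite scoefM_cons splits1_0 big_seq1 /= -IHw //.
  by apply: eq_scoefM => u; rewrite ?mul1r [LHS](fP, gP) [RHS](fP, gP).
rewrite !scoefM_cons; apply: eq_bigr => s _.
by apply: IHw => u; [rewrite fP' thF | exact: gP'].
Qed.

Definition wdeg (w : smon) : nat := \sum_(c <- w) wt c.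

Lemma wdeg_filter w : wdeg (filter nz w) = wdeg w.
Proof.
rewrite /wdeg big_filter big_mkcond; apply: eq_bigr => c _.
by rewrite /nz; case: eqP => // ->.
Qed.

Lemma wdeg_lead alpha : wdeg (lead alpha) = deg alpha.
Proof. by rewrite /wdeg big_map. Qed.

Lemma wdeg_splits w p : p \in splits w -> wdeg w = (wdeg p.1 + wdeg p.2)%N.
Proof.
elim: w p => [|c w IHw] p /=; first by rewrite inE => /eqP ->; rewrite /wdeg !big_nil.
case/allpairsPdep => [[a b]] [q [/= ]].
rewrite mem_splits1 => /and3P[ab /eqP c1 /eqP c2] /IHw wE -> /=.
rewrite /wdeg !big_cons -!/(wdeg _) wE addnACA; congr addn.
rewrite /wt c1 c2 addnACA; congr addn.
by move: ab; case: (a.1); case: (b.1).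
Qed.

Lemma linear_expand (K : choiceType) (V : lmodType rat)
    (F : {malg rat[K]} -> V) : linear F -> F =1 lext (fun k => F << k >>).
Proof.
move=> linF; pose L := GRing.isLinear.Build rat {malg rat[K]} V _ F linF.
pose F' : {linear {malg rat[K]} -> V} := HB.pack F L.
exact: (lext_unique F').
Qed.

Lemma linear_ext_eq (K : choiceType) (V : lmodType rat)
    (F G : {malg rat[K]} -> V) : linear F -> linear G ->
  (forall k, F << k >> = G << k >>) -> F =1 G.
Proof.
move=> linF linG FG a; rewrite (linear_expand linF) (linear_expand linG).
exact: eq_lext.
Qed.

Section BlextTheory.
Variables (K L : choiceType) (V : lmodType rat) (f : K -> L -> V).

Lemma blextPl c x y b : blext f (c *: x + y) b = c *: blext f x b + blext f y b.
Proof. exact: blext_linear_l. Qed.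

Lemma blextPr a c x y : blext f a (c *: x + y) = c *: blext f a x + blext f a y.
Proof. exact: blext_linear_r. Qed.

Lemma blextE a b : blext f a b =
  \sum_(k <- msupp a) \sum_(l <- msupp b) (a@_k * b@_l) *: f k l.
Proof.
apply: eq_bigr => k _; rewrite scaler_sumr; apply: eq_bigr => l _.
by rewrite scalerA.
Qed.
End BlextTheory.

Lemma mcoeff_sum_uniq (K : choiceType) (s : seq K) (c : K -> rat) k : uniq s ->
  (\sum_(l <- s) c l *: << l >> : {malg rat[K]})@_k = c k *+ (k \in s).
Proof.
move=> s_uniq; rewrite raddf_sum /=.
under eq_bigr => l _ do rewrite mcoeffZ mcoeffU.
case: (boolP (k \in s)) => k_s.
  rewrite (bigD1_seq k) //= eqxx mulr1 big1 ?addr0 // => l /negPf ->.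
  by rewrite mulr0.
rewrite big_seq big1 // => l l_s; case: eqP => [lk|_]; last by rewrite mulr0.
by rewrite -lk l_s in k_s.
Qed.

(* a is the quasisymmetric function \sum_alpha a@_alpha M_alpha, see [ser] *)
Notation sQSym := {malg rat[dcomp]}.
Notation sQSym2 := {malg rat[(dcomp * dcomp)%type]}.

Definition ser_coef (a : sQSym) (w : smon) : rat :=
  \sum_(alpha <- msupp a) a@_alpha * M alpha w.

Lemma ser_coef_pad a w : ser_coef a (rcons w (false, 0%N)) = ser_coef a w.
Proof. by apply: eq_bigr => alpha _; rewrite coef_pad. Qed.

Definition ser (a : sQSym) : sseries := SSeries (ser_coef_pad a).

Lemma ser_lead a alpha : ser a (lead alpha) = a@_alpha.
Proof.
rewrite /= /ser_coef.
under eq_bigr => beta _ do rewrite /= McoefE filter_lead (inj_eq lead_inj).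
case: (msuppP a alpha) => a_alpha.
  rewrite (bigD1_seq alpha) ?fset_uniq //= eqxx mulr1 big1 ?addr0 // => beta.
  by rewrite eq_sym => /negPf ->; rewrite mulr0.
rewrite big_seq big1 // => beta; case: eqP => [<-|_]; last by rewrite mulr0.
by rewrite (negPf a_alpha).
Qed.

Lemma ser_inj a b : ser a =1 ser b -> a = b.
Proof. by move=> ab; apply/malgP => alpha; rewrite -!ser_lead ab. Qed.

(* lead alpha is a monomial of M_alpha and of no other M_delta *)
Definition Mmul (beta gamma : dcomp) : sQSym :=
  \sum_(delta <- dcomps (deg beta + deg gamma))
     smul (M beta) (M gamma) (lead delta) *: << delta >>.

Definition qmul : sQSym -> sQSym -> sQSym := blext Mmul.

Lemma ser_linear w : linear (fun a : sQSym => ser a w : rat^o).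
Proof. exact: (lext_is_linear (fun alpha => M alpha w : rat^o)). Qed.

Lemma serU alpha : ser << alpha >> =1 M alpha.
Proof.
by move=> w; rewrite /= /ser_coef msuppU oner_eq0 big_seq_fset1 mcoeffUU mul1r.
Qed.

Lemma smul_deg beta gamma w :
  smul (M beta) (M gamma) w != 0 -> wdeg w = (deg beta + deg gamma)%N.
Proof.
apply: contraNeq => ne_w; rewrite /= /scoefM big_seq big1 // => p p_w.
rewrite !McoefE; case: eqP => [pb|]; last by rewrite mul0r mulr0.
case: eqP => [pg|]; last by rewrite !mulr0.
case/eqP: ne_w; rewrite (wdeg_splits p_w) -(wdeg_filter p.1) -(wdeg_filter p.2).
by rewrite pb pg !wdeg_lead.
Qed.

Lemma leadP w : exists alpha, filter nz w = lead alpha.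
Proof.
elim: w => [|c w [alpha IHw]] /=; first by exists [::].
case: ifP => c_nz; last by exists alpha.
have c_part : c.1 || (0 < c.2)%N by case: c c_nz => [[] []].
by exists (exist _ c c_part :: alpha); rewrite IHw.
Qed.

Lemma ser_Mmul beta gamma : ser (Mmul beta gamma) =1 smul (M beta) (M gamma).
Proof.
move=> w; have [delta def_w] := leadP w.
have nzE f : (forall u, f u = f (filter nz u)) -> f w = f (lead delta) :> rat.
  by move=> fP; rewrite fP def_w.
have MP alpha u : M alpha u = M alpha (filter nz u).
  by rewrite /= !McoefE filter_id.
transitivity (ser (Mmul beta gamma) (lead delta)).
  by apply: nzE => u; apply: eq_bigr => alpha _; rewrite MP.
rewrite ser_lead mcoeff_sum_uniq ?dcomps_uniq // mem_dcomps.
have -> : smul (M beta) (M gamma) w = smul (M beta) (M gamma) (lead delta).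
  by apply: nzE => u; apply: scoefM_quasi => v; apply: MP.
rewrite -wdeg_lead; case: eqP => //; rewrite mulr0n => /eqP ne_d.
by apply/esym/eqP; apply: contraNT ne_d => /smul_deg ->.
Qed.

Lemma ser_qmul a b : ser (qmul a b) =1 smul (ser a) (ser b).
Proof.
move=> w; rewrite (_ : ser _ w =
  \sum_(k <- msupp a) \sum_(l <- msupp b) a@_k * b@_l * smul (M k) (M l) w).
  rewrite /= /scoefM; under eq_bigr do under eq_bigr do rewrite mulr_sumr.
  under eq_bigr do rewrite exchange_big.
  rewrite exchange_big /=; apply: eq_bigr => p _.
  rewrite /ser_coef big_distrlr mulr_sumr; apply: eq_bigr => k _.
  rewrite mulr_sumr; apply: eq_bigr => l _ /=.
  by rewrite mulrCA mulrACA.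
rewrite (linear_expand (ser_linear w)).
rewrite /qmul blextE linear_sum; apply: eq_bigr => k _.
rewrite linear_sum; apply: eq_bigr => l _; rewrite linearZ /=; congr (_ * _).
by rewrite -[RHS]ser_Mmul -(linear_expand (ser_linear w)).
Qed.

Definition qcomul : sQSym -> sQSym2 :=
  lext (fun alpha =>
    \sum_(k < (size alpha).+1) << (take k alpha, drop k alpha) >>).

(* the underlying space; the coefficient of F at alpha is its coordinate on
   H_alpha *)
Notation nsym := {malg rat[dcomp]}.
Notation nsym2 := {malg rat[(dcomp * dcomp)%type]}.

Definition H (alpha : dcomp) : nsym := << alpha >>.

Definition tens (F G : nsym) : nsym2 :=
  blext (fun alpha beta => << (alpha, beta) >>) F G.

Definition pair (F : nsym) (a : sQSym) : rat :=
  blext (fun alpha beta => (alpha == beta)%:R : rat^o) F a.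

(* p = H_p.1 (x) H_p.2, q = M_q.1 (x) M_q.2 *)
Definition tpair (X : nsym2) (Y : sQSym2) : rat :=
  blext (fun p q : dcomp * dcomp =>
    (-1) ^+ (ferm p.2 * ferm q.1) *
      (pair (H p.1) << q.1 >> * pair (H p.2) << q.2 >>) : rat^o) X Y.

(* Product and coproduct are the expansions, in the bases H_alpha and
   H_beta (x) H_gamma, of the elements prescribed by the duality laws
   [pair_nmul] and [pair_ncomul]. *)
Definition nmul (F G : nsym) : nsym :=
  blext (fun beta gamma => \sum_(alpha <- dcomps (deg beta + deg gamma))
    tpair (tens (H beta) (H gamma)) (qcomul << alpha >>) *: << alpha >>) F G.

Definition ncomul (F : nsym) : nsym2 :=
  lext (fun alpha =>
    \sum_(d < (deg alpha).+1)
      \sum_(beta <- dcomps d) \sum_(gamma <- dcomps (deg alpha - d))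
        ((-1) ^+ (ferm gamma * ferm beta) *
           pair (H alpha) (qmul << beta >> << gamma >>)) *: << (beta, gamma) >>) F.

Lemma pairU alpha beta : pair (H alpha) << beta >> = (alpha == beta)%:R.
Proof. by rewrite -[LHS]/(blext _ << _ >> << _ >>) blextU. Qed.

Lemma pairU_coef alpha (a : sQSym) : pair (H alpha) a = a@_alpha.
Proof.
move: a; apply: (@linear_ext_eq _ rat^o) => [c x y|c x y|beta].
- exact: blextPr.
- by rewrite mcoeffD mcoeffZ.
by rewrite pairU mcoeffU eq_sym.
Qed.

Lemma pair_coef (F : nsym) alpha : pair F << alpha >> = F@_alpha.
Proof.
move: F; apply: (@linear_ext_eq _ rat^o) => [c x y|c x y|beta].
- exact: blextPl.
- by rewrite mcoeffD mcoeffZ.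
by rewrite mcoeffU; exact: blextU.
Qed.

Lemma tensU alpha beta : tens (H alpha) (H beta) = << (alpha, beta) >>.
Proof. by rewrite -[LHS]/(blext _ << _ >> << _ >>) blextU. Qed.

Lemma tpairU p q : tpair << p >> << q >> =
  (-1) ^+ (ferm p.2 * ferm q.1) * ((p.1 == q.1)%:R * (p.2 == q.2)%:R).
Proof. by rewrite /tpair blextU !pairU. Qed.

Lemma qcomulU alpha : qcomul << alpha >> =
  \sum_(k < (size alpha).+1) << (take k alpha, drop k alpha) >>.
Proof. exact: lextU. Qed.

Lemma tpair_qcomul beta gamma alpha :
  tpair << (beta, gamma) >> (qcomul << alpha >>) =
  (-1) ^+ (ferm beta * ferm gamma) * (alpha == beta ++ gamma)%:R.
Proof.
rewrite qcomulU; transitivity (\sum_(k < (size alpha).+1)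
    tpair << (beta, gamma) >> << (take k alpha, drop k alpha) >>).
  by rewrite /tpair linear_sum.
under eq_bigr => k _ do rewrite tpairU /=.
case: (alpha =P beta ++ gamma) => [->|ne]; last first.
  rewrite mulr0 big1 // => k _.
  case: (beta =P take k alpha) => [b|_]; last by rewrite mul0r mulr0.
  case: (gamma =P drop k alpha) => [g|_]; last by rewrite !mulr0.
  by case: ne; rewrite b g cat_take_drop.
have lt_b : (size beta < (size (beta ++ gamma)).+1)%N by rewrite ltnS size_cat leq_addr.
rewrite (bigD1 (Ordinal lt_b)) //= take_size_cat // drop_size_cat // !eqxx !mulr1.
rewrite mulnC big1 ?addr0 // => k ne_k.
case: (beta =P _) => [b|_]; last by rewrite mul0r mulr0.
case/eqP: ne_k; apply: val_inj => /=.
by move/(congr1 size): b; rewrite size_takel // -ltnS ltn_ord.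
Qed.

Lemma nmulU beta gamma :
  nmul (H beta) (H gamma) = (-1) ^+ (ferm beta * ferm gamma) *: H (beta ++ gamma).
Proof.
rewrite /nmul [LHS]blextU; apply/malgP => alpha.
rewrite mcoeff_sum_uniq ?dcomps_uniq // mem_dcomps tensU tpair_qcomul.
rewrite mcoeffZ mcoeffU [_ == alpha]eq_sym.
case: eqP => [->|_]; first by rewrite deg_cat eqxx.
by rewrite mulr0 mul0rn.
Qed.

Lemma nmulPl c (x y G : nsym) : nmul (c *: x + y) G = c *: nmul x G + nmul y G.
Proof. exact: blextPl. Qed.

Lemma nmulPr c (x y F : nsym) : nmul F (c *: x + y) = c *: nmul F x + nmul F y.
Proof. exact: blextPr. Qed.

Lemma tpairPl c x y Y : tpair (c *: x + y) Y = c * tpair x Y + tpair y Y.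
Proof. by rewrite /tpair blextPl. Qed.

Lemma tpairPr c x y X : tpair X (c *: x + y) = c * tpair X x + tpair X y.
Proof. by rewrite /tpair blextPr. Qed.

Lemma pairPl c (x y : nsym) a : pair (c *: x + y) a = c * pair x a + pair y a.
Proof. by rewrite /pair blextPl. Qed.

Lemma pairPr c x y F : pair F (c *: x + y) = c * pair F x + pair F y.
Proof. by rewrite /pair blextPr. Qed.

Lemma tensPl c x y G : tens (c *: x + y) G = c *: tens x G + tens y G.
Proof. exact: blextPl. Qed.

Lemma tensPr c x y F : tens F (c *: x + y) = c *: tens F x + tens F y.
Proof. exact: blextPr. Qed.

Lemma qmulPl c x y b : qmul (c *: x + y) b = c *: qmul x b + qmul y b.
Proof. exact: blextPl. Qed.

Lemma qmulPr c x y a : qmul a (c *: x + y) = c *: qmul a x + qmul a y.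
Proof. exact: blextPr. Qed.

Lemma ncomulP c (x y : nsym) : ncomul (c *: x + y) = c *: ncomul x + ncomul y.
Proof. exact: lext_is_linear. Qed.

Lemma qcomulP c x y : qcomul (c *: x + y) = c *: qcomul x + qcomul y.
Proof. exact: lext_is_linear. Qed.

Lemma pair_nmul F G a : pair (nmul F G) a = tpair (tens F G) (qcomul a).
Proof.
move: F; apply: (@linear_ext_eq _ rat^o) => [c x y|c x y|beta].
- by rewrite nmulPl pairPl.
- by rewrite tensPl tpairPl.
move: G; apply: (@linear_ext_eq _ rat^o) => [c x y|c x y|gamma].
- by rewrite nmulPr pairPl.
- by rewrite tensPr tpairPl.
move: a; apply: (@linear_ext_eq _ rat^o) => [c x y|c x y|alpha].
- by rewrite pairPr.
- by rewrite qcomulP tpairPr.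
rewrite -!/(H _) nmulU tensU tpair_qcomul pair_coef mcoeffZ mcoeffU.
by rewrite eq_sym.
Qed.

Lemma tpair_coef X p : tpair X << p >> = (-1) ^+ (ferm p.2 * ferm p.1) * X@_p.
Proof.
move: X; apply: (@linear_ext_eq _ rat^o) => [c x y|c x y|q].
- exact: tpairPl.
- by rewrite mcoeffD mcoeffZ mulrDr mulrCA.
rewrite tpairU mcoeffU; case: p q => [p1 p2] [q1 q2] /=.
rewrite xpair_eqE; case: (q1 =P p1) => [_|_]; last by rewrite mul0r !mulr0.
by case: (q2 =P p2) => [->|_]; rewrite ?mulr1 ?mulr0.
Qed.

Lemma ncomulU alpha p :
  (ncomul (H alpha))@_p = (-1) ^+ (ferm p.2 * ferm p.1) *
                            pair (H alpha) (qmul << p.1 >> << p.2 >>).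
Proof.
case: p => beta gamma /=.
have deg_pair : pair (H alpha) (qmul << beta >> << gamma >>) != 0 ->
    deg alpha = (deg beta + deg gamma)%N.
  rewrite pairU_coef /qmul blextU mcoeff_sum_uniq ?dcomps_uniq // mem_dcomps.
  by case: (deg alpha =P _); rewrite ?eqxx.
rewrite /ncomul lextU; pose c (b g : dcomp) : rat :=
  (-1) ^+ (ferm g * ferm b) * pair (H alpha) (qmul << b >> << g >>).
rewrite raddf_sum /=; transitivity (\sum_(d < (deg alpha).+1)
    c beta gamma *+ ((deg beta == d) && (deg gamma == deg alpha - d)%N)).
  apply: eq_bigr => d _; rewrite -!mem_dcomps.
  transitivity ((\sum_(p <- [seq (b, g) | b <- dcomps d, g <- dcomps (deg alpha - d)])
     c p.1 p.2 *: << p >> : nsym2)@_(beta, gamma)).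
    by rewrite big_allpairs.
  rewrite mcoeff_sum_uniq /=; last first.
    by apply: allpairs_uniq; rewrite ?dcomps_uniq // => -[b g] [b' g'].
  congr (_ *+ nat_of_bool _); apply/allpairsP/andP => [[[b g] [/= ? ? [-> ->]]] //|[? ?]].
  by exists (beta, gamma).
have [c0|c_neq0] := eqVneq (c beta gamma) 0.
  by rewrite -/(c _ _) c0 big1 // => d _; rewrite mul0rn.
have deg_a : deg alpha = (deg beta + deg gamma)%N.
  by apply: deg_pair; apply: contraNneq c_neq0 => p0; rewrite /c p0 mulr0.
have sub_b : (deg alpha - deg beta)%N = deg gamma by rewrite deg_a addKn.
have lt_b : (deg beta < (deg alpha).+1)%N by rewrite ltnS deg_a leq_addr.
rewrite (bigD1 (Ordinal lt_b)) //= sub_b !eqxx big1 ?addr0 // => d.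
by move/negPf; rewrite -val_eqE /= eq_sym => ->.
Qed.

Lemma pair_ncomul F a b : pair F (qmul a b) = tpair (ncomul F) (tens a b).
Proof.
move: F; apply: (@linear_ext_eq _ rat^o) => [c x y|c x y|alpha].
- exact: pairPl.
- by rewrite ncomulP tpairPl.
move: a; apply: (@linear_ext_eq _ rat^o) => [c x y|c x y|beta].
- by rewrite qmulPl pairPr.
- by rewrite tensPl tpairPr.
move: b; apply: (@linear_ext_eq _ rat^o) => [c x y|c x y|gamma].
- by rewrite qmulPr pairPr.
- by rewrite tensPr tpairPr.
rewrite -!/(H _) tensU tpair_coef ncomulU /= mulrA -exprD addnn -mul2n.
by rewrite exprM sqrrN !expr1n mul1r.
Qed.

Lemma nmulZl c F G : nmul (c *: F) G = c *: nmul F G.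
Proof.
have n0 : nmul 0 G = 0.
  have /(congr1 (fun x => x - nmul 0 G)) := nmulPl 1 0 0 G.
  by rewrite scaler0 scale1r add0r subrr addrK.
by rewrite -[c *: F]addr0 nmulPl n0 addr0.
Qed.

Lemma nmulZr c F G : nmul F (c *: G) = c *: nmul F G.
Proof.
have n0 : nmul F 0 = 0.
  have /(congr1 (fun x => x - nmul F 0)) := nmulPr 1 0 0 F.
  by rewrite scaler0 scale1r add0r subrr addrK.
by rewrite -[c *: G]addr0 nmulPr n0 addr0.
Qed.

(* the constant coefficient *)
Definition qcounit (a : sQSym) : rat := ser a [::].

Lemma pair_one a : pair (H [::]) a = qcounit a.
Proof. by rewrite pairU_coef -ser_lead. Qed.

Lemma nmulA : associative nmul.
Proof.
move=> F G K; move: F; apply: linear_ext_eq => [c x y|c x y|a].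
- by rewrite nmulPl.
- by rewrite !nmulPl.
move: G; apply: linear_ext_eq => [c x y|c x y|b].
- by rewrite nmulPl nmulPr.
- by rewrite nmulPr nmulPl.
move: K; apply: linear_ext_eq => [c x y|c x y|k].
- by rewrite !nmulPr.
- by rewrite nmulPr.
rewrite -!/(H _) !nmulU nmulZl nmulZr !nmulU !scalerA -!exprD !ferm_cat catA.
congr ((-1) ^+ _ *: _); rewrite mulnDl mulnDr.
by rewrite [LHS]addnC addnA.
Qed.

Lemma nmul1 : left_id (H [::]) nmul.
Proof.
apply: linear_ext_eq => [c x y|//|k]; first by rewrite nmulPr.
by rewrite -/(H k) nmulU /= scale1r.
Qed.

Lemma nmulr1 : right_id (H [::]) nmul.
Proof.
apply: linear_ext_eq => [c x y|//|k]; first by rewrite nmulPl.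
by rewrite -/(H k) nmulU muln0 scale1r cats0.
Qed.

Lemma nmulDl : left_distributive nmul +%R.
Proof. by move=> F G K; rewrite -[F]scale1r nmulPl !scale1r. Qed.

Lemma nmulDr : right_distributive nmul +%R.
Proof. by move=> F G K; rewrite -[G]scale1r nmulPr !scale1r. Qed.

Lemma H0_neq0 : H [::] != 0.
Proof. by rewrite monalgU_eq0 oner_eq0. Qed.

Lemma nmulAl c F G : c *: nmul F G = nmul (c *: F) G.
Proof. by rewrite nmulZl. Qed.

Definition sNSym : Type := nsym.
HB.instance Definition _ := GRing.Lmodule.copy sNSym nsym.
HB.instance Definition _ := GRing.Zmodule_isNzRing.Build sNSym
  nmulA nmul1 nmulr1 nmulDl nmulDr H0_neq0.
HB.instance Definition _ := GRing.Lmodule_isLalgebra.Build rat sNSym nmulAl.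

Definition Delta : sNSym -> nsym2 := ncomul.

(* (F1 (x) G1) (F2 (x) G2) = (-1)^(deg G1 * deg F2) F1 F2 (x) G1 G2 *)
Definition tmul : nsym2 -> nsym2 -> nsym2 :=
  blext (fun p q => (-1) ^+ (ferm p.2 * ferm q.1) *:
           tens (nmul (H p.1) (H q.1)) (nmul (H p.2) (H q.2))).

Definition Hn (n : nat) : sNSym := if n is m.+1 then H [:: nondotS m] else 1.
Definition Ht (n : nat) : sNSym := H [:: dot n].

(* The free associative algebra over rat on one generator for each part:
   the generators H_m (m >= 1) are indexed by the non-dotted parts, the
   generators \tilde H_n by the dotted ones. *)
Notation freeAlg := {malg rat[{fmonom part}]}.
Definition gen (p : part) : freeAlg := << fmu p >>.

(* Main.v *)
(* Since M_alpha has coproduct the sum of its deconcatenations, H_alpha H_beta is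
   +- H_(alpha ++ beta); a word p_1 ... p_l in the generators is thus sent to
   (-1)^(f choose 2) H_(p_1, ..., p_l), where f is its number of dotted parts, so
   bases correspond up to signs.  Dually, Delta H_alpha is a signed sum over the
   factorizations +- u v of the leading monomial of M_alpha, each contributing
   H (x) H at the compositions read off u and v.  A factorization of a
   concatenation is a pair of factorizations, and comparing the signs shows that
   Delta is multiplicative; a one-part composition gives Delta on generators. *)

Require Import Defs.
From HB Require Import structures.
From mathcomp Require Import all_boot all_order all_algebra.
From mathcomp Require Import finmap.
From mathcomp.multinomials Require Import monalg.

Set Implicit Arguments.
Unset Strict Implicit.
Unset Printing Implicit Defensive.

Import GRing.Theory.
Local Open Scope ring_scope.

(** * Linear and bilinear extensions on sums over a basis *)

Lemma lext_sum (K : choiceType) (V : lmodType rat) (f : K -> V)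
    (I : Type) (r : seq I) (c : I -> rat) (k : I -> K) :
  lext f (\sum_(i <- r) c i *: << k i >>) = \sum_(i <- r) c i *: f (k i).
Proof.
by rewrite linear_sum; apply: eq_bigr => i _; rewrite linearZ /= lextU.
Qed.

Lemma blext_sum (K L : choiceType) (V : lmodType rat) (f : K -> L -> V)
    (I J : Type) (r : seq I) (s : seq J) (c : I -> rat) (d : J -> rat)
    (k : I -> K) (l : J -> L) :
  blext f (\sum_(i <- r) c i *: << k i >>) (\sum_(j <- s) d j *: << l j >>) =
  \sum_(i <- r) \sum_(j <- s) (c i * d j) *: f (k i) (l j).
Proof.
rewrite /blext lext_sum; apply: eq_bigr => i _.
by rewrite lext_sum scaler_sumr; apply: eq_bigr => j _; rewrite scalerA.
Qed.

Lemma tmulPl c x y Y : tmul (c *: x + y) Y = c *: tmul x Y + tmul y Y.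
Proof. exact: blextPl. Qed.

Lemma tmulPr c x y X : tmul X (c *: x + y) = c *: tmul X x + tmul X y.
Proof. exact: blextPr. Qed.

Lemma tensZ c d F G : tens (c *: F) (d *: G) = (c * d) *: tens F G.
Proof.
rewrite /tens /blext linearZ -scalerA; congr (_ *: _); rewrite /= !unlock_lext.
by rewrite scaler_sumr; apply: eq_bigr => k _; rewrite linearZ /= !scalerA mulrC.
Qed.

(* erases the zero exponents: [M (strip w)] is the only M_alpha containing w *)
Definition strip (w : smon) : dcomp := pmap insub w.

Lemma strip_cat u v : strip (u ++ v) = strip u ++ strip v.
Proof. exact: pmap_cat. Qed.

Lemma lead_strip w : lead (strip w) = filter nz w.
Proof.
rewrite /lead /strip (pmap_filter (insubK _)); apply: eq_filter => c.
by case: insubP => [u|]; case: c => [[] []].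
Qed.

Lemma stripP w alpha : (filter nz w == lead alpha) = (strip w == alpha).
Proof. by rewrite -lead_strip (inj_eq lead_inj). Qed.

Lemma ferm_strip w : ferm (strip w) = thdeg w.
Proof.
rewrite -[ferm _](count_map val (fun c => c.1)) -/(lead _) lead_strip.
by rewrite count_filter; apply: eq_count => -[[] n].
Qed.

(** * Factorizations of a monomial and their signs *)

Lemma thdeg_splits w p :
  p \in splits w -> thdeg w = (thdeg p.1 + thdeg p.2)%N.
Proof.
elim: w p => [|c w IHw] p /=; first by rewrite inE => /eqP ->.
case/allpairsPdep => [[a b]] [q [/= ]].
rewrite mem_splits1 => /and3P[ab /eqP c1 _] /IHw wE -> /=.
rewrite /thdeg /= -!/(thdeg _) wE addnACA c1; congr addn.
by move: ab; case: (a.1); case: (b.1).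
Qed.

Lemma thdeg_cat u v : thdeg (u ++ v) = (thdeg u + thdeg v)%N.
Proof. exact: count_cat. Qed.

Lemma size_splits w p : p \in splits w -> size p.1 = size p.2.
Proof. by case: p => u v /mem_splits [-> ->]. Qed.

(** Equal sizes align the variables of the two blocks: every theta of [u2] must pass every theta of
    [v1], while those of [u1] and [v2] are already in order. *)
Lemma inv_cat u1 u2 v1 v2 : size u1 = size v1 ->
  Defs.inv (u1 ++ u2) (v1 ++ v2) =
  (Defs.inv u1 v1 + Defs.inv u2 v2 + thdeg v1 * thdeg u2)%N.
Proof.
elim: u1 v1 => [|a u1 IHu] [|b v1] //= => [_|[/IHu IH]].
  by rewrite /Defs.inv big_ord0 /= mul0n addn0.
rewrite !inv_cons IH thdeg_cat -/(thdeg v1).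
rewrite mulnDr mulnDl -!addnA; congr addn; rewrite [RHS]addnCA; congr addn.
by rewrite addnC -addnA.
Qed.

Lemma splits_cat (w1 w2 : smon) : splits (w1 ++ w2) =
  [seq (p.1 ++ q.1, p.2 ++ q.2) | p <- splits w1, q <- splits w2].
Proof.
elim: w1 => [|c w1 IHw] /=.
  by rewrite cats0 -[LHS]map_id; apply: eq_map => -[].
rewrite IHw; elim: (splits1 c) => //= s r ->.
by rewrite allpairs_cat map_allpairs allpairs_mapl.
Qed.

(** * The coproduct on the basis and its multiplicativity *)

(** By duality, the coefficient at [(beta, gamma)] is, up to the sign of the tensor pairing, that of
    [lead alpha] in M_beta M_gamma. Each factorization counts for exactly one such pair. *)
Lemma Delta_basis alpha : Delta (H alpha) =
  \sum_(p <- splits (lead alpha))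
     (-1) ^+ (Defs.inv p.1 p.2 + thdeg p.1 * thdeg p.2) *:
       << (strip p.1, strip p.2) >>.
Proof.
apply/malgP => -[beta gamma]; rewrite /Delta ncomulU pairU_coef -ser_lead.
rewrite /qmul blextU ser_Mmul /= /scoefM mulr_sumr raddf_sum /=.
apply: eq_bigr => p _; rewrite !McoefE !stripP mcoeffZ mcoeffU xpair_eqE.
case: eqP => [<-|_]; last by rewrite /= mul0r !mulr0.
case: eqP => [<-|_]; last by rewrite /= !mulr0.
by rewrite !mulr1 !ferm_strip exprD mulrC [X in _ = _ * _ ^+ X]mulnC.
Qed.

Lemma DeltaM F G : Delta (F * G) = tmul (Delta F) (Delta G).
Proof.
rewrite /Delta -[F * G]/(nmul F G).
move: F; apply: linear_ext_eq => [c x y|c x y|a].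
- by rewrite nmulPl ncomulP.
- by rewrite ncomulP tmulPl.
move: G; apply: linear_ext_eq => [c x y|c x y|b].
- by rewrite nmulPr ncomulP.
- by rewrite ncomulP tmulPr.
rewrite -!/(H _) nmulU -/Delta.
transitivity ((-1) ^+ (ferm a * ferm b) *: Delta (H (a ++ b))).
  exact: (linearZ_LR (lext _)).
rewrite !Delta_basis /tmul blext_sum /lead map_cat splits_cat big_allpairs_dep.
rewrite scaler_sumr; apply: eq_big_seq => p pa.
rewrite scaler_sumr; apply: eq_big_seq => q qb /=.
rewrite !nmulU tensZ tensU !strip_cat !scalerA -!exprD; congr (_ *: _).
rewrite inv_cat ?(size_splits pa) // !ferm_strip !thdeg_cat.
have -> : ferm a = (thdeg p.1 + thdeg p.2)%N.
  by rewrite -(thdeg_splits pa) /thdeg count_map.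
have -> : ferm b = (thdeg q.1 + thdeg q.2)%N.
  by rewrite -(thdeg_splits qb) /thdeg count_map.
(* Both exponents are polynomials in two inversion numbers and four theta degrees, so checking all
   parities of these six numbers suffices. *)
rewrite -[LHS]signr_odd -[RHS]signr_odd; congr (_ ^+ nat_of_bool _).
rewrite !(oddD, oddM).
move: (odd (thdeg p.1)) (odd (thdeg p.2)) (odd (thdeg q.1)) (odd (thdeg q.2)).
by move: (odd (Defs.inv p.1 p.2)) (odd (Defs.inv q.1 q.2)); do 6!case.
Qed.

(** * The coproduct on generators *)

Lemma splits_seq1 c :
  splits [:: c] = [seq ([:: s.1], [:: s.2]) | s <- splits1 c].
Proof. by rewrite /=; elim: (splits1 c) => //= s r ->. Qed.

(** This covers [n = 0] too: [strip] drops the zero exponent, leaving the empty composition, whose H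
    is 1. *)
Lemma Hn_strip n : Hn n = H (strip [:: (false, n)]).
Proof.
rewrite [LHS](_ : _ = H (if n is m.+1 then [:: nondotS m] else [::])).
  by congr H; apply: lead_inj; rewrite lead_strip; case: n.
by case: n.
Qed.

Lemma Ht_strip n : Ht n = H (strip [:: (true, n)]).
Proof. by congr H; apply: lead_inj; rewrite lead_strip. Qed.

(** No sign survives, since at most one of the two factors receives the theta. *)
Lemma Delta_part (p : part) : Delta (H [:: p]) =
  \sum_(s <- splits1 (val p)) tens (H (strip [:: s.1])) (H (strip [:: s.2])).
Proof.
rewrite Delta_basis splits_seq1 big_map.
apply: eq_big_seq => -[a b] /=; rewrite mem_splits1 => /and3P[ab _ _].
rewrite tensU inv_cons /Defs.inv big_ord0 /thdeg /= !addn0 muln0 add0n.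
by move: ab; case: (a.1); case: (b.1) => // _; rewrite scale1r.
Qed.

Lemma Delta_Hn n : (0 < n)%N ->
  Delta (Hn n) = \sum_(i < n.+1) tens (Hn i) (Hn (n - i)).
Proof.
case: n => // n _; rewrite Delta_part /splits1 [LHS]big_allpairs_dep big_seq1.
rewrite -[iota _ _]/(index_iota 0 n.+2) big_mkord.
by apply: eq_bigr => i _; rewrite !Hn_strip.
Qed.

Lemma Delta_Ht n : Delta (Ht n) =
  \sum_(k < n.+1) (tens (Ht k) (Hn (n - k)) + tens (Hn (n - k)) (Ht k)).
Proof.
have iotaE (E : nat -> nsym2) :
    \sum_(k <- iota 0 n.+1) E k = \sum_(k < n.+1) E k.
  by rewrite -[iota _ _]/(index_iota 0 n.+1) big_mkord.
rewrite Delta_part /splits1 [LHS]big_allpairs_dep big_cons big_seq1.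
rewrite [RHS]big_split; congr (_ + _); rewrite iotaE.
  by apply: eq_bigr => i _; rewrite Hn_strip Ht_strip.
(* When the theta goes right, the splits run over the exponent of the left factor, which is the
   index of the H, not of the dotted generator. *)
rewrite [RHS](reindex_inj rev_ord_inj); apply: eq_bigr => i _ /=.
by rewrite subSS subKn ?Hn_strip ?Ht_strip // -ltnS.
Qed.

Lemma Delta1 : Delta 1 = tens (1 : sNSym) (1 : sNSym).
Proof.
by rewrite [LHS]Delta_basis big_seq1 [RHS]tensU /Defs.inv big_ord0 /= scale1r.
Qed.

(** * The isomorphism with the free algebra *)

Definition Hprod (m : seq part) : sNSym := \prod_(p <- m) (H [:: p] : sNSym).

(** Prepending a dotted part to f dotted parts costs (-1)^f, and C(f+1, 2) = C(f, 2) + f. *)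
Lemma HprodE m : Hprod m = (-1) ^+ 'C(ferm m, 2) *: H m.
Proof.
rewrite /Hprod; elim: m => [|p m IHm]; first by rewrite big_nil scale1r.
rewrite big_cons IHm -[LHS]/(nmul _ _) nmulZr nmulU scalerA -exprD.
congr (_ ^+ _ *: _); rewrite /ferm /= addn0.
by case: (dotted p); rewrite ?add1n ?binS ?bin1 ?mul1n ?mul0n ?addn0.
Qed.

Definition from_free : freeAlg -> sNSym :=
  lext (fun m : {fmonom part} => Hprod m).

(** The sign of [HprodE] is its own inverse, so the same sign serves for the way back. *)
Definition to_free : sNSym -> freeAlg :=
  lext (fun alpha => (-1) ^+ 'C(ferm alpha, 2) *: << FMonom alpha >>).

Lemma from_freeU m : from_free << m >> = Hprod m.
Proof. exact: lextU. Qed.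

Lemma to_freeU alpha :
  to_free << alpha >> = (-1) ^+ 'C(ferm alpha, 2) *: << FMonom alpha >>.
Proof. exact: lextU. Qed.

HB.instance Definition _ := GRing.Linear.copy from_free
  (lext (fun m : {fmonom part} => Hprod m)).
HB.instance Definition _ := GRing.Linear.copy to_free
  (lext (fun alpha : dcomp => (-1) ^+ 'C(ferm alpha, 2) *: << FMonom alpha >>)).

(** In this form, multiplicativity of [from_free] can be checked on basis words by
    [linear_ext_eq]. *)
Lemma malg_mulE (K : monomType) (x y : {malg rat[K]}) :
  x * y = blext (fun k l : K => << mmul k l >>) x y.
Proof.
rewrite blextE malgME; apply: eq_bigr => k _; apply: eq_bigr => l _.
by apply/malgP => m; rewrite mcoeffZ !mcoeffU mulrnAr mulr1.
Qed.

Lemma from_freeM : {morph from_free : x y / x * y}.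
Proof.
move=> x y; rewrite malg_mulE -[RHS]/(nmul _ _).
move: x; apply: linear_ext_eq => [c x x'|c x x'|m].
- by rewrite blextPl linearP.
- by rewrite linearP nmulPl.
move: y; apply: linear_ext_eq => [c y y'|c y y'|m'].
- by rewrite blextPr linearP.
- by rewrite linearP nmulPr.
by rewrite blextU !from_freeU /Hprod fmM big_cat.
Qed.

Lemma from_free1 : from_free 1 = 1.
Proof. by rewrite [LHS]from_freeU fm1 /Hprod big_nil. Qed.

HB.instance Definition _ := GRing.isMonoidMorphism.Build freeAlg sNSym from_free
  (conj from_free1 from_freeM).

Lemma from_freeK : cancel from_free to_free.
Proof.
apply: (@linear_ext_eq _ _ (to_free \o from_free) idfun) => [||m];
  [exact: linearP | exact: linearP |].
rewrite -[LHS]/(to_free (from_free << m >>)).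
rewrite from_freeU HprodE linearZ /= to_freeU scalerA -expr2 sqrr_sign.
by rewrite scale1r; case: m.
Qed.

Lemma to_freeK : cancel to_free from_free.
Proof.
apply: (@linear_ext_eq _ _ (from_free \o to_free) idfun) => [||a];
  [exact: linearP | exact: linearP |].
rewrite -[LHS]/(from_free (to_free << a >>)).
rewrite to_freeU linearZ /= from_freeU HprodE scalerA -expr2 sqrr_sign.
by rewrite scale1r.
Qed.

Lemma from_free_gen p : from_free (gen p) = H [:: p].
Proof. by rewrite [LHS]from_freeU fmuE /Hprod big_seq1. Qed.

Theorem proposition6p2 :
  (exists phi : {lrmorphism freeAlg -> sNSym},
    [/\ bijective phi,
        forall m : nat, phi (gen (nondotS m)) = Hn m.+1
      & forall n : nat, phi (gen (dot n)) = Ht n]) /\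
  [/\ Delta 1 = tens (1 : sNSym) (1 : sNSym),
      forall F G : sNSym, Delta (F * G) = tmul (Delta F) (Delta G),
      forall n : nat, (0 < n)%N ->
        Delta (Hn n) = \sum_(i < n.+1) tens (Hn i) (Hn (n - i))
    & forall i : nat,
        Delta (Ht i) =
        \sum_(k < i.+1) (tens (Ht k) (Hn (i - k)) + tens (Hn (i - k)) (Ht k))].
Proof.
split.
  exists from_free; split=> [|m|n]; try exact: from_free_gen.
  exact: Bijective from_freeK to_freeK.
by split; [exact: Delta1 | exact: DeltaM | exact: Delta_Hn | exact: Delta_Ht].
Qed.
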